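(* Let $L$ be a congruence uniform lattice. The following are equivalent: (i) $L$ is extremal; (ii) $L$ is left modular; (iii) $L$ is $EL$-shellable (admits an $EL$-labelling); (iv) $L$ is shellable.
   Context: All lattices are finite. A lattice is congruence uniform if it is obtained from the one-element lattice by successive doublings of nonempty intervals, where for an interval (more generally a convex subset) $C$ of $L$, with $I_L(C)=\{y\mid\exists x\in C,\ y\le x\}$, the doubling $L[C]$ is the subposet of $L\times\{0<1\}$ on $\big(I_L(C)\times\{0\}\big)\sqcup\big(((L\setminus I_L(C))\cup C)\times\{1\}\big)$. $L$ is extremal if its length (maximum number of elements of a chain minus one) equals both its number of join-irreducible and of meet-irreducible elements. An element $a$ is left modular if for all $b<c$, $(b\vee a)\wedge c=b\vee(a\wedge c)$; $L$ is left modular if it has a maximal chain of left modular elements. An $EL$-labelling is a map $\lambda$ from the cover relations of $L$ to a poset such that in every interval $[x,y]$ there is a unique maximal chain whose label sequence (read from bottom to top) is increasing, and its label sequence lexicographically precedes that of every other maximal chain of $[x,y]$. The order complex of $L$ has the chains of $L$ as faces; $L$ is shellable if its facets (maximal chains) admit a linear order $F_1,\dots,F_k$ such that for each $j<k$, $\big(\bigcup_{i\le j}\langle F_i\rangle\big)\cap\langle F_{j+1}\rangle$ is pure of dimension $|F_{j+1}|-2$, with $\langle F\rangle$ the set of subsets of $F$. *)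

(* Defs.v *)
From HB Require Import structures.
From mathcomp Require Import all_boot all_order.
Set Implicit Arguments. Unset Strict Implicit. Unset Printing Implicit Defensive.
Import Order.TTheory.
Local Open Scope order_scope.

(* A finite poset is encoded as a duplicate-free list [s] of elements of
   [seq bool] together with an order relation [le] (only its restriction to
   [s] matters).  An element (x, b) of L x {0<1} is encoded as [b :: x]. *)

Definition interval (s : seq (seq bool)) (le : rel (seq bool)) (a b : seq bool)
  : seq (seq bool) := [seq z <- s | le a z && le z b].

Definition downset (s : seq (seq bool)) (le : rel (seq bool)) (C : seq (seq bool))
  : seq (seq bool) := [seq y <- s | has (fun x => le y x) C].

Definition double_elts (s : seq (seq bool)) (le : rel (seq bool))
  (C : seq (seq bool)) : seq (seq bool) :=
  [seq false :: y | y <- s & y \in downset s le C] ++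
  [seq true :: y | y <- s & (y \notin downset s le C) || (y \in C)].

Definition double_le (le : rel (seq bool)) : rel (seq bool) :=
  fun u v => match u, v with
             | b :: x, b' :: y => le x y && (b <= b')%N
             | _, _ => false
             end.

Inductive cu_poset : seq (seq bool) -> rel (seq bool) -> Prop :=
| cu_one : cu_poset [:: [::]] (fun _ _ => true)
| cu_double s le a b :
    cu_poset s le -> a \in s -> b \in s -> le a b ->
    cu_poset (double_elts s le (interval s le a b)) (double_le le).

Section LatticeDefs.
Context {d : Order.disp_t} {T : finTBLatticeType d}.

Definition order_iso (s : seq (seq bool)) (le : rel (seq bool)) (f : T -> seq bool) :=
  [/\ injective f, forall x, f x \in s, (forall y, y \in s -> exists x, f x = y)
    & forall x y : T, (x <= y) = le (f x) (f y)].

Definition congruence_uniform : Prop :=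
  exists s le (f : T -> seq bool), cu_poset s le /\ order_iso s le f.

Definition chain (A : {set T}) : Prop :=
  forall x y, x \in A -> y \in A -> (x <= y) || (y <= x).

Definition maximal_chain (A : {set T}) : Prop :=
  chain A /\ forall B : {set T}, chain B -> A \subset B -> B = A.

Definition chainb (A : {set T}) : bool :=
  [forall x in A, forall y in A, (x <= y) || (y <= x)].

Definition lattice_length : nat :=
  ((\max_(A : {set T} | chainb A) #|A|) - 1)%N.

Definition join_irreducible (x : T) : bool :=
  (x != \bot) && [forall y, forall z, (y `|` z == x) ==> (y == x) || (z == x)].

Definition meet_irreducible (x : T) : bool :=
  (x != \top) && [forall y, forall z, (y `&` z == x) ==> (y == x) || (z == x)].

Definition extremal : Prop :=
  lattice_length = #|[set x : T | join_irreducible x]| /\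
  lattice_length = #|[set x : T | meet_irreducible x]|.

Definition left_modular_elt (a : T) : Prop :=
  forall b c : T, b < c -> (b `|` a) `&` c = b `|` (a `&` c).

Definition left_modular : Prop :=
  exists A : {set T}, maximal_chain A /\ forall a, a \in A -> left_modular_elt a.

Definition covers (x y : T) : bool := (x < y) && [forall z, ~~ ((x < z) && (z < y))].

Definition max_chain_of (x y : T) (s : seq T) : bool :=
  path covers x s && (last x s == y).

Definition lex_lt {dQ : Order.disp_t} {Q : porderType dQ} (u v : seq Q) : Prop :=
  (exists p a b u' v', [/\ u = p ++ a :: u', v = p ++ b :: v' & a < b])
  \/ (exists b v', v = u ++ b :: v').

Definition labels {Q : Type} (lam : T -> T -> Q) (x : T) (s : seq T) : seq Q :=
  pairmap lam x s.

Definition EL_labelling {dQ : Order.disp_t} {Q : porderType dQ} (lam : T -> T -> Q) : Prop :=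
  forall x y : T, x <= y ->
    exists s, [/\ max_chain_of x y s, sorted <=%O (labels lam x s),
      (forall t, max_chain_of x y t -> sorted <=%O (labels lam x t) -> t = s)
    & (forall t, max_chain_of x y t -> t <> s -> lex_lt (labels lam x s) (labels lam x t))].

Definition EL_shellable : Prop :=
  exists (dQ : Order.disp_t) (Q : porderType dQ) (lam : T -> T -> Q), EL_labelling lam.

(* faces = chains of T, facets = maximal chains *)
Definition shelling (F : seq {set T}) : Prop :=
  [/\ uniq F, (forall A, A \in F <-> maximal_chain A) &
    forall j, (0 < j < size F)%N ->
      let Fj := nth set0 F j in
      let K := fun G : {set T} => G \subset Fj /\ exists2 i, (i < j)%N & G \subset nth set0 F i in
      forall G, K G -> (forall H, K H -> G \subset H -> H = G) -> #|G| = (#|Fj| - 1)%N].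

Definition shellable : Prop := exists F, shelling F.

End LatticeDefs.

(* Main.v *)
(* Call (j, m) a kappa pair when j is not below m, every z above j `&` m is above j or below m, and dually for j `|` m; then
   j is join-irreducible, m is meet-irreducible and m = kappa(j).  An induction on doublings shows that in a congruence
   uniform lattice any b < c are separated by a kappa pair (j <= c, b <= m).  Hence every cover carries exactly one kappa
   pair, labels along a chain are distinct, the numbers of join- and meet-irreducibles both equal the number n of kappa
   pairs, and L is extremal iff some maximal chain carries all n labels.
   - Along a chain of length n, the labels enumerate the kappa pairs so that j <= m' whenever (j, m) comes before (j', m').
     Such an enumeration yields a chain of left modular elements (the joins of initial segments), and labelling covers by
     position is an EL-labelling whose lexicographic order on maximal chains is a shelling.
   - Conversely, a is left modular iff j <= a or a <= m for all kappa pairs, so a left modular maximal chain carries every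
     label.  If x covers b, is covered by c, and is bypassed by another chain from b to c, then the two labels around x
     reappear on that chain.  So passing to an earlier facet of a shelling, or to a lexicographically earlier chain by
     resolving a descent of an EL-labelling, never loses labels, and the first chain carries all of them. *)

Require Import Defs.
From mathcomp Require Import all_boot all_order.

Set Implicit Arguments. Unset Strict Implicit. Unset Printing Implicit Defensive.
Import Order.TTheory.
Local Open Scope order_scope.

(** * Kappa pairs under the doubling of an interval *)

Section Doubling.

Implicit Types (s : seq (seq bool)) (le : rel (seq bool)).

Definition order_on s le : Prop :=
  [/\ {in s, reflexive le}, {in s & &, transitive le} & {in s &, antisymmetric le}].

(* The hypotheses on z say that z lies above the meet, resp. below the join, of j and m,
   without assuming that these exist. *)
Definition poset_kappa_pair s le (j m : seq bool) : Prop :=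
  [/\ j \in s, m \in s, ~~ le j m,
      forall z, z \in s -> (forall w, w \in s -> le w j -> le w m -> le w z) ->
        le j z || le z m
    & forall z, z \in s -> (forall w, w \in s -> le j w -> le m w -> le z w) ->
        le j z || le z m].

Definition separated_by_kappa_pairs s le : Prop :=
  forall x y, x \in s -> y \in s -> le x y -> x != y ->
    exists j m, [/\ poset_kappa_pair s le j m, le j y & le x m].

Section OneDoubling.

Context (s : seq (seq bool)) (le : rel (seq bool)) (a b : seq bool).
Hypotheses (le_order : order_on s le) (a_s : a \in s) (b_s : b \in s) (le_ab : le a b).

Let s' := double_elts s le (interval s le a b).
Let le' := double_le le.

Lemma le_on_refl x : x \in s -> le x x.
Proof. by case: le_order => r _ _; apply: r. Qed.

Lemma le_on_trans y x z : x \in s -> y \in s -> z \in s -> le x y -> le y z -> le x z.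
Proof. by case: le_order => _ t _ xs ys zs; apply: t. Qed.

Lemma le_on_anti x y : x \in s -> y \in s -> le x y -> le y x -> x = y.
Proof. by case: le_order => _ _ t xs ys h1 h2; apply: t => //; rewrite h1. Qed.

Lemma mem_downset_interval y : y \in s ->
  (y \in downset s le (interval s le a b)) = le y b.
Proof.
move=> ys; rewrite mem_filter ys andbT; apply/hasP/idP => [[x]|yb].
  rewrite mem_filter => /andP[/andP[_ xb] xs] yx.
  exact: (le_on_trans (y := x)).
by exists b => //; rewrite mem_filter le_ab b_s le_on_refl.
Qed.

Lemma mem_double e x : (e :: x \in s') =
  (x \in s) && (if e then ~~ le x b || le a x else le x b).
Proof.
have inj e' : injective (cons e' : seq bool -> seq bool) by move=> ? ? [].
have mem1 e' (r : seq (seq bool)) :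
    (e :: x \in [seq e' :: y | y <- r]) = (e == e') && (x \in r).
  have [->|ne] := eqVneq e e'; first by rewrite (mem_map (@inj e')).
  by apply/negP => /mapP[y _ [/eqP]]; rewrite (negbTE ne).
rewrite mem_cat !mem1 mem_filter [X in _ || (_ && X)]mem_filter /=.
case: (boolP (x \in s)) => [xs|_]; last by rewrite !andbF.
rewrite mem_downset_interval // mem_filter xs !andbT; case: e mem1 => /= _; last by rewrite orbF.
by case: (le x b); rewrite ?andbT ?andbF.
Qed.

Lemma nil_double : [::] \notin s'.
Proof. by rewrite mem_cat; apply/negP => /orP[] /mapP[]. Qed.

Lemma double_order : order_on s' le'.
Proof.
split.
- case=> [|e x]; first by rewrite (negbTE nil_double).
  by rewrite mem_double => /andP[xs _] /=; rewrite le_on_refl ?leqnn.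
- case=> [|ey y] [|ex x] [|ez z]; rewrite ?(negbTE nil_double) //.
  rewrite !mem_double => /andP[ys _] /andP[xs _] /andP[zs _] /=.
  move=> /andP[xy exy] /andP[yz eyz].
  by rewrite (le_on_trans xs ys zs) // (leq_trans exy).
- case=> [|ey y] [|ex x]; rewrite ?(negbTE nil_double) //.
  rewrite !mem_double => /andP[ys _] /andP[xs _] /=.
  move=> /andP[/andP[xy exy] /andP[yx eyx]].
  rewrite (le_on_anti ys xs) //; congr cons.
  by move: exy eyx; case: (ey); case: (ex).
Qed.

(** With [fibre_max], the least and greatest elements over [x] for the projection of the doubling to
    [s]. They are the left and right adjoints of this projection, which is what lifts kappa
    pairs. *)
Definition fibre_min x := (~~ le x b) :: x.
Definition fibre_max x := (~~ le x b || le a x) :: x.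

Lemma fibre_min_in x : x \in s -> fibre_min x \in s'.
Proof. by move=> xs; rewrite mem_double xs /=; case: (boolP (le x b)). Qed.

Lemma fibre_max_in x : x \in s -> fibre_max x \in s'.
Proof. by move=> xs; rewrite mem_double xs /=; case: (le x b) => //=; case: (le a x). Qed.

Lemma fibre_min_le x e y : x \in s -> e :: y \in s' -> le' (fibre_min x) (e :: y) = le x y.
Proof.
rewrite mem_double => xs /andP[ys hy] /=; case: (boolP (le x y)) => //= xy.
case: (boolP (le x b)) => //= nxb.
case: e hy => // yb.
by case/negP: nxb; apply: (le_on_trans xs ys).
Qed.

Lemma le_fibre_max x e y : x \in s -> e :: y \in s' -> le' (e :: y) (fibre_max x) = le y x.
Proof.
rewrite mem_double => xs /andP[ys hy] /=; case: (boolP (le y x)) => //= yx.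
case: e hy => //= h; case: (boolP (le x b)) => //= xb.
move: h; rewrite (le_on_trans ys xs b_s) //= => ay.
by rewrite (le_on_trans a_s ys xs).
Qed.

Lemma double_kappa_pair_new : poset_kappa_pair s' le' (true :: a) (false :: b).
Proof.
split.
- by rewrite mem_double a_s le_on_refl // orbT.
- by rewrite mem_double b_s le_on_refl.
- by rewrite /= andbF.
- case=> [|e z]; first by rewrite (negbTE nil_double).
  (* [false :: a] is the meet of the new pair; its join, used in the dual clause, is [true :: b]. *)
  move=> zs' /(_ (false :: a)).
  rewrite mem_double a_s le_ab /= le_on_refl // le_ab => /(_ isT isT isT) /andP[az _].
  by rewrite az; move: zs'; rewrite mem_double => /andP[_]; case: e => //= ->.
- case=> [|e z]; first by rewrite (negbTE nil_double).
  move=> zs' /(_ (true :: b)).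
  rewrite mem_double b_s le_ab orbT /= le_ab le_on_refl // => /(_ isT isT isT) /andP[zb _].
  by rewrite zb; move: zs'; rewrite mem_double => /andP[_]; rewrite zb /=; case: e => [->|_] //=; rewrite orbT.
Qed.

(** The adjunctions turn each comparison with the lifted pair into one in [s]. A common lower bound
    [w] is tested through [fibre_min w], a common upper bound through [fibre_max w]. *)
Lemma double_kappa_pair_old j m : poset_kappa_pair s le j m ->
  poset_kappa_pair s' le' (fibre_min j) (fibre_max m).
Proof.
case=> js ms jm kl ku; split; rewrite ?fibre_min_in ?fibre_max_in //.
- by rewrite fibre_min_le ?fibre_max_in.
- case=> [|e z]; first by rewrite (negbTE nil_double).
  move=> zs' h; have := zs'; rewrite mem_double => /andP[zs _].
  rewrite fibre_min_le // le_fibre_max //; apply: kl => // w ws wj wm.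
  have := h (fibre_min w) (fibre_min_in ws).
  by rewrite !fibre_min_le ?fibre_min_in ?fibre_max_in //; apply.
- case=> [|e z]; first by rewrite (negbTE nil_double).
  move=> zs' h; have := zs'; rewrite mem_double => /andP[zs _].
  rewrite fibre_min_le // le_fibre_max //; apply: ku => // w ws wj wm.
  have := h (fibre_max w) (fibre_max_in ws).
  by rewrite !le_fibre_max ?fibre_min_in ?fibre_max_in //; apply.
Qed.

(** Distinct elements of one fibre lie over the doubled interval and are separated by the new pair.
    In different fibres, a pair separating the projections lifts. *)
Lemma double_separated : separated_by_kappa_pairs s le -> separated_by_kappa_pairs s' le'.
Proof.
move=> sep [|ex x] [|ey y]; rewrite ?(negbTE nil_double) // => xs' ys'.
have := xs'; have := ys'; rewrite !mem_double => /andP[ys hy] /andP[xs hx].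
move=> /andP[xy exy] ne.
have [exy'|nxy] := eqVneq x y.
  move: ne exy hx hy; rewrite exy'; case: ex {xs'}; case: ey {ys'}; rewrite ?eqxx //.
  move=> _ _ yb; rewrite yb /= => ay.
  exists (true :: a), (false :: b); split=> /=; rewrite ?yb ?ay //.
  exact: double_kappa_pair_new.
have [j [m [jm jy xm]]] := sep _ _ xs ys xy nxy.
have [js ms _ _ _] := jm.
exists (fibre_min j), (fibre_max m).
by split; [exact: double_kappa_pair_old | rewrite fibre_min_le | rewrite le_fibre_max].
Qed.

End OneDoubling.

Lemma cu_poset_separated s le :
  cu_poset s le -> order_on s le /\ separated_by_kappa_pairs s le.
Proof.
elim=> [|{}s {}le a b _ [ord sep] a_s b_s ab].
  split; first by split=> // x y; rewrite !inE => /eqP-> /eqP->.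
  by move=> x y; rewrite !inE => /eqP-> /eqP-> _ /eqP.
by split; [exact: double_order | exact: double_separated].
Qed.

End Doubling.

(** * Kappa pairs as labels of covers in a lattice *)

Section KappaPairs.

Context {d : Order.disp_t} {T : finTBLatticeType d}.
Implicit Types (x y z a b c : T) (p q : T * T) (A B : {set T}).

Definition kappa_pair (p : T * T) : bool :=
  [&& ~~ (p.1 <= p.2),
      [forall z, (p.1 `&` p.2 <= z) ==> (p.1 <= z) || (z <= p.2)]
    & [forall z, (z <= p.1 `|` p.2) ==> (p.1 <= z) || (z <= p.2)]].

(** Used for covers, and also for general [b < c], where it says that the pair separates [b] from
    [c]. *)
Definition labels_edge p b c : bool := [&& kappa_pair p, p.1 <= c & b <= p.2].

Definition kappa_separated : Prop := forall b c, b < c -> exists p, labels_edge p b c.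

(** In a lattice, lying above every common lower bound of j and m means lying above their meet, so
    the conditions on posets carry over along the isomorphism. *)
Lemma congruence_uniform_separated : @congruence_uniform d T -> kappa_separated.
Proof.
case=> s [le [f [/cu_poset_separated[_ sep] [inj fs surj ord]]]] b c bc.
have := sep (f b) (f c) (fs _) (fs _).
rewrite -ord ltW // (inj_eq inj) => /(_ isT).
rewrite lt_eqF // => /(_ isT) [j' [m' [[/surj[j <-] /surj[m <-] jm kl ku] jc bm]]].
exists (j, m); rewrite /labels_edge /kappa_pair /= !ord jm jc bm /= andbT.
apply/andP; split; apply/forallP => z; apply/implyP => hz; rewrite !ord.
  apply: kl => // w' /surj[w <-]; rewrite -!ord => wj wm.
  by apply: le_trans hz; rewrite lexI wj.
apply: ku => // w' /surj[w <-]; rewrite -!ord => wj wm.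
by apply: le_trans hz _; rewrite leUx wj.
Qed.

Lemma kappa_neq p : kappa_pair p -> p.1 <= p.2 = false.
Proof. by case/and3P => /negbTE. Qed.

Lemma kappa_meet_le p z : kappa_pair p -> p.1 `&` p.2 <= z -> (p.1 <= z) || (z <= p.2).
Proof. by case/and3P => _ /forallP/(_ z)/implyP. Qed.

Lemma kappa_le_join p z : kappa_pair p -> z <= p.1 `|` p.2 -> (p.1 <= z) || (z <= p.2).
Proof. by case/and3P => _ _ /forallP/(_ z)/implyP. Qed.

Lemma kappa_lt p z : kappa_pair p -> z < p.1 -> z <= p.2.
Proof.
move=> kp zp; have := @kappa_le_join p z kp (le_trans (ltW zp) (leUl _ _)).
by rewrite (lt_geF zp).
Qed.

Lemma kappa_gt p z : kappa_pair p -> p.2 < z -> p.1 <= z.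
Proof.
move=> kp zp; have := @kappa_meet_le p z kp (le_trans (leIr _ _) (ltW zp)).
by rewrite (lt_geF zp) orbF.
Qed.

Lemma covers_lt x y : covers x y -> x < y.
Proof. by case/andP. Qed.

Lemma covers_eq x y z : covers x y -> x <= z -> z <= y -> z != x -> z = y.
Proof.
case/andP=> _ /forallP/(_ z) h xz zy zx; apply/eqP; apply: contraNT h => ne.
by rewrite !lt_neqAle eq_sym zx xz ne zy.
Qed.

Lemma covers_above x y : x < y -> exists2 z, covers x z & z <= y.
Proof.
move: {2}#|_|.+1 (ltnSn #|[set z | (x < z) && (z < y)]|) => k.
elim: k y => // k IH y; rewrite ltnS => hk xy.
have [cov|] := boolP (covers x y); first by exists y.
rewrite negb_and xy /= => /forallPn[z]; rewrite negbK => /andP[xz zy].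
have [] := IH z _ xz; last by move=> w xw wz; exists w => //; apply: le_trans wz (ltW zy).
apply: leq_trans hk; apply: proper_card; apply/properP; split.
  by apply/subsetP=> w; rewrite !inE => /andP[-> /lt_trans->].
by exists z; rewrite !inE ?xz ?zy ?ltxx ?andbF.
Qed.

Lemma covers_below x y : x < y -> exists2 z, covers z y & x <= z.
Proof.
move: {2}#|_|.+1 (ltnSn #|[set z | (x < z) && (z < y)]|) => k.
elim: k x => // k IH x; rewrite ltnS => hk xy.
have [cov|] := boolP (covers x y); first by exists x.
rewrite negb_and xy /= => /forallPn[z]; rewrite negbK => /andP[xz zy].
have [] := IH z _ zy; last by move=> w wy zw; exists w => //; apply: le_trans (ltW xz) zw.
apply: leq_trans hk; apply: proper_card; apply/properP; split.
  by apply/subsetP=> w; rewrite !inE => /andP[/(lt_trans xz)-> ->].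
by exists z; rewrite !inE ?xz ?zy ?ltxx ?andbF.
Qed.

Lemma labels_edge_not_le p b c : labels_edge p b c -> p.1 <= b = false.
Proof.
by case/and3P => kp _ bp; apply/negP => /le_trans/(_ bp); rewrite kappa_neq.
Qed.

Lemma labels_edge_not_ge p b c : labels_edge p b c -> c <= p.2 = false.
Proof.
by case/and3P => kp pc _; apply/negP => /(le_trans pc); rewrite kappa_neq.
Qed.

Lemma labels_edge_join p b c : covers b c -> labels_edge p b c -> b `|` p.1 = c.
Proof.
move=> cov lab; have [kp pc bp] := and3P lab; apply: (covers_eq cov).
- exact: leUl.
- by rewrite leUx (ltW (covers_lt cov)).
- by apply/eqP => e; have := labels_edge_not_le lab; rewrite -e leUr.
Qed.

Lemma labels_edge_meet p b c : covers b c -> labels_edge p b c -> c `&` p.2 = b.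
Proof.
move=> cov lab; have [kp pc bp] := and3P lab.
apply/eqP; apply/negPn/negP => ne; have := labels_edge_not_ge lab.
by rewrite -[X in X <= _](covers_eq cov _ (leIl _ p.2) ne) ?leIr // lexI ltW ?covers_lt.
Qed.

(** Let (j, m) and (j', m') label the cover. As [c] is the join of [b] and j, both it and j' lie
    below the join of j and m, so j <= j' or j' <= m; the latter would put [c] below m. Dually m' <=
    m, and exchanging the pairs gives equality. *)
Lemma labels_edge_uniq p q b c :
  covers b c -> labels_edge p b c -> labels_edge q b c -> p = q.
Proof.
move=> cov.
suff h r r' : labels_edge r b c -> labels_edge r' b c -> (r.1 <= r'.1) && (r'.2 <= r.2).
  move=> lp lq; have /andP[h1 h2] := h _ _ lp lq; have /andP[h3 h4] := h _ _ lq lp.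
  by rewrite [p]surjective_pairing [q]surjective_pairing;
    congr pair; apply/le_anti/andP.
move=> lr lr'; have [kr rc br] := and3P lr; have [kr' rc' br'] := and3P lr'.
apply/andP; split.
  have := @kappa_le_join r r'.1 kr; case/(_ _)/orP => [||r'r] //.
    apply: le_trans rc' _; rewrite -(labels_edge_join cov lr) leUx leUl andbT.
    by apply: le_trans br (leUr _ _).
  have := labels_edge_not_ge lr.
  by rewrite -[X in X <= _](labels_edge_join cov lr') leUx br r'r.
have := @kappa_meet_le r r'.2 kr; case/(_ _)/orP => [|r'r|] //.
  apply: le_trans br'; rewrite -(labels_edge_meet cov lr) lexI leIr andbT.
  exact: le_trans (leIl _ _) rc.
have := labels_edge_not_ge lr'.
by rewrite -[X in X <= _](labels_edge_join cov lr) leUx br' r'r.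
Qed.

(** Everything strictly below j is below m, so the meet of j and m is the only lower cover of j. *)
Lemma kappa_covers p : kappa_pair p -> covers (p.1 `&` p.2) p.1.
Proof.
move=> kp; apply/andP; split.
  by rewrite lt_neqAle leIl andbT -leEmeet kappa_neq.
apply/forallP => z; apply/negP => /andP[pz zp].
by move: pz; rewrite le_gtF // lexI (ltW zp) kappa_lt.
Qed.

Lemma kappa_labels_edge p : kappa_pair p -> labels_edge p (p.1 `&` p.2) p.1.
Proof. by move=> kp; rewrite /labels_edge kp lexx leIr. Qed.

Lemma kappa_covers_dual p : kappa_pair p -> covers p.2 (p.1 `|` p.2).
Proof.
move=> kp; apply/andP; split.
  by rewrite lt_neqAle leUr andbT eq_sym -leEjoin kappa_neq.
apply/forallP => z; apply/negP => /andP[pz zp].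
by move: zp; rewrite le_gtF // leUx (ltW pz) kappa_gt.
Qed.

Lemma kappa_labels_edge_dual p : kappa_pair p -> labels_edge p p.2 (p.1 `|` p.2).
Proof. by move=> kp; rewrite /labels_edge kp lexx leUl. Qed.

Definition kappa_pairs : {set T * T} := [set p | kappa_pair p].

(** Pairs with the same j both label the cover below j. *)
Lemma kappa_fst_inj : {in kappa_pairs &, injective fst}.
Proof.
move=> p q; rewrite !inE => kp kq e.
apply: (labels_edge_uniq (kappa_covers kp) (kappa_labels_edge kp)).
by rewrite /labels_edge kq e lexx -e kappa_lt // -?e ?covers_lt ?kappa_covers.
Qed.

Lemma kappa_snd_inj : {in kappa_pairs &, injective snd}.
Proof.
move=> p q; rewrite !inE => kp kq e.
apply: (labels_edge_uniq (kappa_covers_dual kp) (kappa_labels_edge_dual kp)).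
by rewrite /labels_edge kq e lexx -e kappa_gt // -?e ?covers_lt ?kappa_covers_dual.
Qed.

(** * Irreducibles, left modular elements and lengths of chains *)

Section Separated.

Hypothesis sep : kappa_separated.

(** The bijection is [fst]. A join-irreducible x covers some w and is the join of w with the j of
    that cover, so x = j. Conversely, elements strictly below j lie below m, and so do their
    joins. *)
Lemma card_join_irreducible : #|[set x : T | join_irreducible x]| = #|kappa_pairs|.
Proof.
rewrite -(card_in_imset kappa_fst_inj); apply: eq_card => x; rewrite inE.
apply/idP/imsetP => [|[p]]; last first.
  rewrite inE => kp ->; apply/andP; split.
    by apply/eqP => e; have := kappa_neq kp; rewrite e le0x.
  apply/forallP => y; apply/forallP => z; apply/implyP => /eqP e.
  have := kappa_neq kp; apply: contraFT; rewrite negb_or => /andP[yp zp].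
  by rewrite -[X in X <= _]e leUx !kappa_lt // lt_neqAle ?yp ?zp -e ?leUl ?leUr.
case/andP; rewrite -lt0x => x0 /forallP ji; have [w wx _] := covers_below x0.
have [p lab] := sep (covers_lt wx).
have := ji w => /forallP/(_ p.1)/implyP.
rewrite (labels_edge_join wx lab) eqxx lt_eqF ?covers_lt //= => /(_ isT)/eqP <-.
by exists p => //; rewrite inE; case/and3P: lab.
Qed.

Lemma card_meet_irreducible : #|[set x : T | meet_irreducible x]| = #|kappa_pairs|.
Proof.
rewrite -(card_in_imset kappa_snd_inj); apply: eq_card => x; rewrite inE.
apply/idP/imsetP => [|[p]]; last first.
  rewrite inE => kp ->; apply/andP; split.
    by apply/eqP => e; have := kappa_neq kp; rewrite e lex1.
  apply/forallP => y; apply/forallP => z; apply/implyP => /eqP e.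
  have := kappa_neq kp; apply: contraFT; rewrite negb_or => /andP[yp zp].
  by rewrite -[X in _ <= X]e lexI !kappa_gt // lt_neqAle eq_sym ?yp ?zp -e ?leIl ?leIr.
case/andP; rewrite -ltx1 => x1 /forallP mi; have [w wx _] := covers_above x1.
have [p lab] := sep (covers_lt wx).
have := mi w => /forallP/(_ p.2)/implyP.
rewrite (labels_edge_meet wx lab) eqxx gt_eqF ?covers_lt //= => /(_ isT)/eqP <-.
by exists p => //; rewrite inE; case/and3P: lab.
Qed.

(** Forwards, the modular identity is applied to the cover below j. Backwards, a failure of the
    identity is separated by a kappa pair (j, m), and either alternative, j <= a or a <= m, then
    forces j <= m. *)
Lemma left_modular_eltP a :
  @left_modular_elt d T a <-> forall p, kappa_pair p -> (p.1 <= a) || (a <= p.2).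
Proof.
split=> [lm p kp|h b c bc].
  have := @kappa_meet_le p (p.1 `&` p.2 `|` a) kp (leUl _ _).
  case/orP => [pa|]; last by rewrite leUx => /andP[_ ->]; rewrite orbT.
  have := lm _ _ (covers_lt (kappa_covers kp)).
  have -> : (p.1 `&` p.2 `|` a) `&` p.1 = p.1 by apply/meet_idPr.
  move=> e; have := @kappa_le_join p (a `&` p.1) kp (le_trans (leIr _ _) (leUl _ _)).
  case/orP => [|ap]; first by rewrite lexI => /andP[->].
  by have := kappa_neq kp; rewrite [X in X <= _]e leUx leIr ap.
apply/eqP; rewrite eq_sym; apply/negPn/negP => ne.
have le : b `|` (a `&` c) <= (b `|` a) `&` c.
  by rewrite leUx !lexI leUl (ltW bc) leIr andbT (le_trans (leIl _ _) (leUr _ _)).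
have [|p /and3P[kp pc bp]] := @sep (b `|` (a `&` c)) ((b `|` a) `&` c).
  by rewrite lt_neqAle ne.
move: pc bp; rewrite lexI leUx => /andP[pba pc] /andP[bp acp].
have := kappa_neq kp; case/orP: (h p kp) => [pa|ap].
  by rewrite (le_trans _ acp) // lexI pa.
by rewrite (le_trans pba) // leUx bp.
Qed.

Lemma lt_path_last x s : path <%O x s -> x <= last x s.
Proof. by elim: s x => //= y s IH x /andP[/ltW xy /IH]; apply: le_trans. Qed.

Lemma lt_path_le_last x s z : path <%O x s -> z \in x :: s -> z <= last x s.
Proof.
elim: s x => [|y s IH] x /=; first by rewrite inE => _ /eqP->.
move=> /andP[xy ys]; rewrite inE => /predU1P[->|]; last exact: IH.
by rewrite (le_trans (ltW xy)) ?lt_path_last.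
Qed.

(** Each step is separated by some kappa pair. The j of a step lies below the start of every later
    step, hence below the later m; the clause [x <= p.2] carries this through the induction. *)
Lemma lt_path_kappa_pairs x s : path <%O x s ->
  exists t : seq (T * T), [/\ size t = size s, all kappa_pair t,
    pairwise (fun p q => p.1 <= q.2) t, all (fun p => p.1 <= last x s) t
    & all (fun p => x <= p.2) t].
Proof.
elim: s x => [|y s IH] x /=; first by exists [::].
case/andP => xy ys; have [t [sz kt pw tl ty]] := IH _ ys.
have [p /and3P[kp py xp]] := sep xy.
exists (p :: t); rewrite /= sz kp kt pw tl xp andbT; split=> //=.
- by rewrite andbT; apply: sub_all ty => q /=; apply: le_trans.
- by rewrite (le_trans py) ?lt_path_last.
- by apply: sub_all ty => q /=; apply: le_trans (ltW xy).
Qed.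

Lemma pairwise_kappa_uniq (t : seq (T * T)) :
  all kappa_pair t -> pairwise (fun p q => p.1 <= q.2) t -> uniq t.
Proof.
elim: t => //= p t IH /andP[kp kt] /andP[hp ht]; rewrite IH // andbT.
by apply/negP => /(allP hp); rewrite kappa_neq.
Qed.

Definition kappa_order (t : seq (T * T)) : Prop :=
  [/\ uniq t, t =i kappa_pairs & pairwise (fun p q => p.1 <= q.2) t].

Lemma lt_path_size x s : path <%O x s -> (size s <= #|kappa_pairs|)%N.
Proof.
move=> /lt_path_kappa_pairs[t [<- kt pw _ _]].
rewrite -(card_uniqP (pairwise_kappa_uniq kt pw)); apply/subset_leq_card/subsetP => p pt.
by rewrite inE (allP kt).
Qed.

Lemma lt_path_kappa_order x s :
  path <%O x s -> (#|kappa_pairs| <= size s)%N -> exists t, kappa_order t.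
Proof.
move=> /lt_path_kappa_pairs[t [<- kt pw _ _]] sz; exists t.
have ut := pairwise_kappa_uniq kt pw; split=> //.
apply/subset_cardP; last by apply/subsetP => p pt; rewrite inE (allP kt).
apply/eqP; rewrite (card_uniqP ut) eqn_leq sz andbT -(card_uniqP ut).
by apply/subset_leq_card/subsetP => p pt; rewrite inE (allP kt).
Qed.

Lemma chainP A : reflect (@chain d T A) (chainb A).
Proof.
apply: (iffP forallP) => [h x y xA yA|h x].
  by have := h x => /implyP/(_ xA)/forallP/(_ y)/implyP/(_ yA).
by apply/implyP => xA; apply/forallP => y; apply/implyP => yA; exact: h.
Qed.

Lemma chain_sort_sorted A : @chain d T A -> sorted <%O (sort <=%O (enum A)).
Proof.
move=> ch; rewrite lt_sorted_uniq_le sort_uniq enum_uniq /=.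
by apply: (sort_sorted_in (P := mem A)) => [x y|]; [exact: ch | apply/allP => x; rewrite mem_enum].
Qed.

Lemma mem_sort_enum A : sort <=%O (enum A) =i A.
Proof. by move=> x; rewrite mem_sort mem_enum. Qed.

Lemma size_sort_enum A : size (sort <=%O (enum A)) = #|A|.
Proof. by rewrite size_sort cardE. Qed.

Lemma chain_card A : @chain d T A -> (#|A| <= #|kappa_pairs|.+1)%N.
Proof.
move=> /chain_sort_sorted; rewrite -size_sort_enum; case: (sort _ _) => //= x s.
exact: lt_path_size.
Qed.

Lemma lt_path_chain x s : path <%O x s -> @chain d T [set z in x :: s].
Proof.
move=> pth y z; rewrite !inE -!in_cons => ys zs.
have st : sorted <=%O (x :: s) by have : sorted <%O (x :: s) by []; rewrite lt_sorted_uniq_le => /andP[].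
case/orP: (leq_total (index y (x :: s)) (index z (x :: s))) => le_i.
  by rewrite (sorted_leq_index le_trans le_refl st).
by rewrite orbC (sorted_leq_index le_trans le_refl st).
Qed.

Lemma lt_path_card x s : path <%O x s -> #|[set z in x :: s]| = (size s).+1.
Proof.
move=> pth; rewrite cardsE; apply/card_uniqP.
by have : sorted <%O (x :: s) by []; rewrite lt_sorted_uniq_le => /andP[].
Qed.

Lemma extremalP :
  @extremal d T <-> exists A, @chain d T A /\ (#|kappa_pairs| < #|A|)%N.
Proof.
rewrite /extremal card_join_irreducible card_meet_irreducible /lattice_length.
have ch1 : chainb [set (\bot : T)].
  by apply/chainP => x y; rewrite !inE => /eqP-> /eqP->; rewrite lexx.
set M := \max_(_ | _) _.
(* Positivity makes the truncated subtraction in [lattice_length] exact. *)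
have M_gt0 : (0 < M)%N by rewrite -(cards1 (\bot : T)); apply: leq_bigmax_cond.
split=> [[e _]|[A [chA hA]]].
  have [A chA eA] : {A : {set T} | chainb A & M = #|A|}.
    by apply: (@eq_bigmax_cond _ (@chainb d T)); apply/card_gt0P; exists [set \bot].
  by exists A; split; [exact/chainP | rewrite -eA -e -[X in (_ < X)%N](subnK M_gt0) addn1].
suff -> : M = #|kappa_pairs|.+1 by rewrite subn1.
apply/eqP; rewrite eqn_leq; apply/andP; split.
  by apply/bigmax_leqP => B /chainP; exact: chain_card.
by apply: leq_trans hA _; apply: leq_bigmax_cond; exact/chainP.
Qed.

Lemma extremal_lt_path x s :
  path <%O x s -> (#|kappa_pairs| <= size s)%N -> @extremal d T.
Proof.
move=> pth sz; apply/extremalP; exists [set z in x :: s].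
by rewrite lt_path_card // ltnS; split=> //; exact: lt_path_chain.
Qed.

Lemma extremal_kappa_order : @extremal d T -> exists t, kappa_order t.
Proof.
move=> /extremalP[A [/chain_sort_sorted]]; rewrite -size_sort_enum.
by case: (sort _ _) => //= x s /lt_path_kappa_order h; rewrite ltnS => /h.
Qed.

(** * Maximal chains and the labels they carry *)

Lemma maximal_chainP A : reflect (@maximal_chain d T A) (maxset chainb A).
Proof.
apply: (iffP maxsetP) => [[/chainP chA h]|[/chainP chA h]]; split=> // B.
  by move/chainP; exact: h.
by move/chainP; exact: h.
Qed.

Lemma maximal_chain_mem A x : @maximal_chain d T A ->
  (forall y, y \in A -> (x <= y) || (y <= x)) -> x \in A.
Proof.
case=> chA mx hx; rewrite -(mx (x |: A)) ?subsetUr ?setU11 // => y z.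
rewrite !inE => /predU1P[->|yA] /predU1P[->|zA]; rewrite ?lexx ?hx //.
  by rewrite orbC hx.
exact: chA.
Qed.

Lemma maximal_chain_bot A : @maximal_chain d T A -> \bot \in A.
Proof. by move=> /maximal_chain_mem; apply=> y _; rewrite le0x. Qed.

Lemma maximal_chain_top A : @maximal_chain d T A -> \top \in A.
Proof. by move=> /maximal_chain_mem; apply=> y _; rewrite lex1 orbT. Qed.

Lemma chain_min A (P : pred T) x : @chain d T A -> x \in A -> P x ->
  exists y, [/\ y \in A, P y & forall z, z \in A -> P z -> y <= z].
Proof.
move=> chA xA Px.
(* On a chain the least element is the one with the smallest principal down-set. *)
case: (@arg_minnP _ x [pred y | (y \in A) && P y] (fun y => #|[set w | w <= y]|)).
  by rewrite /= xA.
move=> y /andP[yA Py] ymin; exists y; split=> // z zA Pz.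
have /orP[//|zy] := chA _ _ yA zA; have : y \in [set w | w <= y] by rewrite inE.
suff <- : [set w | w <= z] = [set w | w <= y] by rewrite inE.
apply/eqP; rewrite eqEcard ymin /= ?zA // andbT.
by apply/subsetP => w; rewrite !inE => /le_trans; apply.
Qed.

Lemma chain_max A (P : pred T) x : @chain d T A -> x \in A -> P x ->
  exists y, [/\ y \in A, P y & forall z, z \in A -> P z -> z <= y].
Proof.
move=> chA xA Px.
case: (@arg_minnP _ x [pred y | (y \in A) && P y] (fun y => #|[set w | y <= w]|)).
  by rewrite /= xA.
move=> y /andP[yA Py] ymin; exists y; split=> // z zA Pz.
have /orP[//|zy] := chA _ _ zA yA; have : y \in [set w | y <= w] by rewrite inE.
suff <- : [set w | z <= w] = [set w | y <= w] by rewrite inE.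
apply/eqP; rewrite eqEcard ymin /= ?zA // andbT.
by apply/subsetP => w; rewrite !inE; apply: le_trans.
Qed.

(** The next element of the chain is a cover in the whole lattice: anything in between would be
    comparable with all of [A], hence belong to [A]. *)
Lemma maximal_chain_succ A x y : @maximal_chain d T A -> x \in A -> y \in A -> x < y ->
  exists2 z, z \in A & covers x z && (z <= y).
Proof.
move=> mA xA yA xy; have [chA _] := mA.
have [z [zA xz zmin]] := @chain_min A (fun z => x < z) y chA yA xy.
exists z => //; rewrite zmin // andbT /covers xz; apply/forallP => w.
apply/negP => /andP[xw wz]; have : w \in A.
  apply: (maximal_chain_mem mA) => v vA; have /orP[vx|xv] := chA _ _ vA xA.
    by rewrite (le_trans vx (ltW xw)) orbT.
  have [e|ne] := eqVneq x v; first by rewrite -e (ltW xw) orbT.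
  by rewrite (le_trans (ltW wz)) // zmin // lt_neqAle ne.
by move=> /zmin/(_ xw) /(lt_le_trans wz); rewrite ltxx.
Qed.

Lemma maximal_chain_pred A x y : @maximal_chain d T A -> x \in A -> y \in A -> x < y ->
  exists2 z, z \in A & covers z y && (x <= z).
Proof.
move=> mA xA yA xy; have [chA _] := mA.
have [z [zA xz zmax]] := @chain_max A (fun z => z < y) x chA xA xy.
exists z => //; rewrite zmax // andbT /covers xz; apply/forallP => w.
apply/negP => /andP[zw wy]; have : w \in A.
  apply: (maximal_chain_mem mA) => v vA; have /orP[vx|xv] := chA _ _ yA vA.
    by rewrite (le_trans (ltW wy) vx).
  have [e|ne] := eqVneq v y; first by rewrite e (ltW wy).
  by rewrite (le_trans _ (ltW zw)) ?orbT // zmax // lt_neqAle ne.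
by move=> /zmax/(_ wy) /(lt_le_trans zw); rewrite ltxx.
Qed.

Definition chain_labels A p : Prop :=
  exists b c, [/\ b \in A, c \in A, covers b c & labels_edge p b c].

(** Sending a kappa pair to the upper end of a cover in [A] that carries it is injective, since in a
    chain the upper end determines the cover and the cover its label. The image misses [\bot], so
    [A] has more elements than there are kappa pairs. *)
Lemma extremal_chain_labels A : @maximal_chain d T A ->
  (forall p, kappa_pair p -> chain_labels A p) -> @extremal d T.
Proof.
move=> mA lA; have [chA _] := mA; apply/extremalP; exists A; split=> //.
pose Q p c := [&& c \in A & [exists b, [&& b \in A, covers b c & labels_edge p b c]]].
(* The default is never taken on kappa pairs, by [fP]. *)
pose f p := odflt \bot [pick c | Q p c].
have fP p : p \in kappa_pairs -> Q p (f p).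
  rewrite inE /f => /lA[b [c [bA cA bc lab]]]; case: pickP => //= /(_ c).
  by rewrite /Q cA /= => /existsP[]; exists b; rewrite bA bc lab.
have f_inj : {in kappa_pairs &, injective f}.
  move=> p q /fP/andP[_ /existsP[b /and3P[bA bc lb]]].
  move=> /fP/andP[_ /existsP[b' /and3P[bA' bc' lb']]] e; move: bc' lb'; rewrite -e => bc' lb'.
  suff e' : b = b' by apply: labels_edge_uniq lb _ => //; rewrite e'.
  have [-> //|ne] := eqVneq b b'; have /orP[h|h] := chA _ _ bA bA'.
    have := covers_eq bc h (ltW (covers_lt bc')).
    by rewrite eq_sym ne => /(_ isT) e'; have := covers_lt bc'; rewrite e' ltxx.
  have := covers_eq bc' h (ltW (covers_lt bc)).
  by rewrite ne => /(_ isT) e'; have := covers_lt bc; rewrite e' ltxx.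
rewrite -(card_in_imset f_inj); apply: proper_card; apply/properP; split.
  by apply/subsetP => c /imsetP[p /fP/andP[cA _] ->].
exists \bot; first exact: maximal_chain_bot.
apply/negP => /imsetP[p /fP/andP[_ /existsP[b /and3P[_ /covers_lt]]]].
by move=> + + e; rewrite -e ltx0.
Qed.

(** Let c be the least element of the chain above j, and b its predecessor. Then j is not below b,
    so left modularity of b gives b <= m, and the cover from b to c carries the pair. *)
Lemma left_modular_extremal : @left_modular d T -> @extremal d T.
Proof.
case=> A [mA lm]; have [chA _] := mA; apply: (extremal_chain_labels mA) => p kp.
have [c [cA pc cmin]] := @chain_min A (fun c => p.1 <= c) \top chA (maximal_chain_top mA) (lex1 _).
have c0 : \bot < c.
  rewrite lt0x; apply: contraFneq (kappa_neq kp) => c0.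
  by apply: le_trans pc _; rewrite c0 le0x.
have [b bA /andP[bc _]] := maximal_chain_pred mA (maximal_chain_bot mA) cA c0.
exists b, c; split=> //; rewrite /labels_edge kp pc /=.
have /orP[pb|//] := (left_modular_eltP b).1 (lm b bA) p kp.
by have := cmin b bA pb; rewrite lt_geF // covers_lt.
Qed.

(** The join [x k] of the first k elements j lies below the m of all remaining pairs, so each pair
    meets the criterion of [left_modular_eltP]. These joins form a chain of the greatest possible
    size, which makes it maximal. *)
Lemma kappa_order_left_modular t : kappa_order t -> @left_modular d T.
Proof.
case=> ut mt pw; pose p0 : T * T := (\bot, \bot).
pose x k := \join_(p <- take k t) p.1.
have join_ge k i : (i < k)%N -> (i < size t)%N -> (nth p0 t i).1 <= x k.
  move=> ik it; apply: (@joins_sup_seq _ _ _ _ xpredT (fun p => p.1) (nth p0 t i)) => //.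
  by rewrite -(nth_take _ ik) mem_nth // size_take; case: ifP.
have join_le k i : (k <= i)%N -> (i < size t)%N -> x k <= (nth p0 t i).2.
  move=> ki it; apply/joinsP_seq => p /(nthP p0)[i']; rewrite size_take => hi' <- _.
  have ik' : (i' < k)%N by move: hi'; case: ifP => // /negbT; rewrite -leqNgt => /(leq_trans _); apply.
  have ii := leq_trans ik' ki.
  rewrite nth_take //; move/(pairwiseP p0): pw => /(_ i' i); apply => //.
  exact: ltn_trans it.
have x_mono k l : (k <= l)%N -> x k <= x l.
  move=> kl; apply/joinsP_seq => p pk _.
  apply: (@joins_sup_seq _ _ _ _ xpredT (fun p => p.1) p) => //.
  by move: pk; rewrite -[in take l t](subnKC kl) takeD mem_cat => ->.
have chx : @chain d T [set x (nat_of_ord k) | k : 'I_(size t).+1].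
  move=> _ _ /imsetP[k _ ->] /imsetP[l _ ->].
  by case/orP: (leq_total k l) => /x_mono -> //; rewrite orbT.
exists [set x (nat_of_ord k) | k : 'I_(size t).+1]; split; last first.
  move=> _ /imsetP[k _ ->]; apply/left_modular_eltP => p kp.
  have pt : p \in t by rewrite mt inE.
  rewrite -(nth_index p0 pt); have it := pt; rewrite -index_mem in it.
  by case: (ltnP (index p t) k) => [/join_ge->|/join_le->] //; rewrite orbT.
split=> // B chB sB; apply/eqP; rewrite eq_sym eqEcard sB /=.
rewrite card_imset ?card_ord => [|k l e].
  by apply: leq_trans (chain_card chB) _; rewrite ltnS -(eq_card mt) (card_uniqP ut).
(* The joins are pairwise distinct: a repetition would put the j at index [u] below its own m. *)
have aux (u v : 'I_(size t).+1) : (u < v)%N -> x u = x v -> False.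
  move=> uv exuv; have us : (u < size t)%N by rewrite (leq_trans uv) // -ltnS.
  have := join_le _ _ (leqnn u) us; rewrite exuv.
  move=> /(le_trans (join_ge _ _ uv us)); rewrite kappa_neq //.
  by have := mem_nth p0 us; rewrite mt inE.
apply: val_inj; case: (ltngtP k l) => // h; first by case: (aux _ _ h e).
by case: (aux _ _ h (esym e)).
Qed.

(** * Exchange of labels across an interval, and shellability *)

Lemma labels_edge_switch_up p b x c y : covers b x -> covers x c -> covers y c ->
  b <= y -> y != x -> labels_edge p b x -> labels_edge p y c.
Proof.
move=> bx xc yc by_ yx lab; have [kp px bp] := and3P lab.
have nxy : x <= y = false.
  apply/negP => xy; have := covers_lt yc.
  by rewrite (covers_eq xc xy (ltW (covers_lt yc)) yx) ltxx.
have xyb : x `&` y = b.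
  apply/eqP/negPn/negP => ne; move/negP: nxy; apply.
  by rewrite -[X in X <= _](covers_eq bx _ (leIl _ y) ne) ?leIr // lexI by_ (ltW (covers_lt bx)).
(* The first alternative is excluded: j would lie below both [x] and [y], hence below their meet
   [b]. *)
have /orP[py|yp] : (p.1 <= y) || (y <= p.2).
  apply: kappa_meet_le => //; apply: le_trans by_.
  by rewrite -(labels_edge_meet bx lab) lexI leIr (le_trans (leIl _ _) px).
  by have := labels_edge_not_le lab; rewrite -xyb lexI px py.
by rewrite /labels_edge kp yp (le_trans px) ?(ltW (covers_lt xc)).
Qed.

Lemma labels_edge_switch_down p b x c y : covers b x -> covers x c -> covers b y ->
  y <= c -> y != x -> labels_edge p x c -> labels_edge p b y.
Proof.
move=> bx xc yb yc yx lab; have [kp pc xp] := and3P lab.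
have nyx : y <= x = false.
  apply/negP => yx'; have e := covers_eq bx (ltW (covers_lt yb)) yx'.
  by move: yx; rewrite e ?eqxx // gt_eqF // covers_lt.
have xyc : x `|` y = c.
  apply: (covers_eq xc); rewrite ?leUl ?leUx ?yc ?(ltW (covers_lt xc)) //.
  by apply: contraFneq nyx => <-; rewrite leUr.
have /orP[py|yp] : (p.1 <= y) || (y <= p.2).
- apply: kappa_le_join => //; apply: le_trans yc _.
  by rewrite -(labels_edge_join xc lab) leUx leUl (le_trans xp (leUr _ _)).
- by rewrite /labels_edge kp py (le_trans _ xp) ?(ltW (covers_lt bx)).
by have := labels_edge_not_ge lab; rewrite -xyc leUx xp yp.
Qed.

(** Only the covers of [A] at [x] can be missing from [B]. Between the neighbours of [x], the first
    cover of [B] carries the upper of the two labels and the last cover carries the lower one. *)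
Lemma chain_labels_switch A B x p :
  @maximal_chain d T A -> @maximal_chain d T B -> A :\ x \subset B ->
  chain_labels A p -> chain_labels B p.
Proof.
move=> mA mB /subsetP sub [b [c [bA cA bc lab]]].
have [xB|xB] := boolP (x \in B).
  have AB z : z \in A -> z \in B.
    by have [-> //|ne zA] := eqVneq z x; apply: sub; rewrite !inE ne.
  by exists b, c; split=> //; apply: AB.
have AB z : z \in A -> z != x -> z \in B by move=> zA zx; apply: sub; rewrite !inE zx.
have x0 : \bot < x by rewrite lt0x; apply: contraNneq xB => ->; exact: maximal_chain_bot.
have x1 : x < \top by rewrite ltx1; apply: contraNneq xB => ->; exact: maximal_chain_top.
have neB z : z \in B -> z != x by move=> zB; apply: contraNneq xB => <-.
have [bx|bx] := eqVneq b x.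
  rewrite bx in bA bc lab.
  have [a aA /andP[ax _]] := maximal_chain_pred mA (maximal_chain_bot mA) bA x0.
  have [aB cB] : a \in B /\ c \in B.
    by split; apply: AB => //; rewrite ?(lt_eqF (covers_lt ax)) ?(gt_eqF (covers_lt bc)).
  have [y yB /andP[ay yc]] := maximal_chain_succ mB aB cB (lt_trans (covers_lt ax) (covers_lt bc)).
  by exists a, y; split=> //; apply: (labels_edge_switch_down ax bc) => //; apply: neB.
have [cx|cx] := eqVneq c x; last by exists b, c; split=> //; apply: AB.
rewrite cx in cA bc lab.
have [e eA /andP[xe _]] := maximal_chain_succ mA cA (maximal_chain_top mA) x1.
have eB : e \in B by apply: AB; rewrite ?(gt_eqF (covers_lt xe)).
have bB := AB b bA bx.
have [y yB /andP[ye bY]] := maximal_chain_pred mB bB eB (lt_trans (covers_lt bc) (covers_lt xe)).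
by exists y, e; split=> //; apply: (labels_edge_switch_up bc xe) => //; apply: neB.
Qed.

Lemma chain_extends A : @chain d T A -> exists2 B, @maximal_chain d T B & A \subset B.
Proof. by move=> /chainP/maxset_exists[B /maximal_chainP mB sB]; exists B. Qed.

Lemma kappa_pair_chain p : kappa_pair p -> exists2 A, @maximal_chain d T A & chain_labels A p.
Proof.
move=> kp; have := ltW (covers_lt (kappa_covers kp)) => le.
have [|A mA /subsetP sA] := @chain_extends [set p.1 `&` p.2; p.1].
  by move=> x y; rewrite !inE => /orP[]/eqP-> /orP[]/eqP->; rewrite ?lexx ?le ?orbT.
exists A => //; exists (p.1 `&` p.2), p.1; rewrite !sA ?inE ?eqxx ?orbT //.
by split=> //; [exact: kappa_covers | exact: kappa_labels_edge].
Qed.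

(** Strong induction on the index of a facet carrying [p] moves the label down to facet 0. *)
Lemma shellable_extremal : @shellable d T -> @extremal d T.
Proof.
case=> F [uF memF shell].
have mF k : (k < size F)%N -> @maximal_chain d T (nth set0 F k).
  by move=> kF; apply/memF; rewrite mem_nth.
have [|A mA _] := @chain_extends set0; first by move=> x y; rewrite inE.
have F0 : (0 < size F)%N by case: (F) (memF A).2 => // /(_ mA).
apply: (extremal_chain_labels (mF 0 F0)) => p /kappa_pair_chain[B /memF BF].
move: (BF); rewrite -index_mem => iF; rewrite -(nth_index set0 BF).
elim/ltn_ind: (index B F) iF => k IH kF lk.
have [k0|k0] := posnP k; first by rewrite -k0.
(* A boolean form of the intersection with earlier facets. It contains the empty face because [k] is
   positive, so it has a maximal face. *)
pose K (G : {set T}) := (G \subset nth set0 F k) && [exists i : 'I_k, G \subset nth set0 F i].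
have [|G /maxsetP[/andP[Gk /existsP[i Gi]] mG] _] := @maxset_exists _ K set0.
  by rewrite /K sub0set; apply/existsP; exists (Ordinal k0); rewrite sub0set.
have cG : #|G| = (#|nth set0 F k| - 1)%N.
  apply: (shell k _ G) => [||H [Hk [i' i'k Hi']] GH]; first by rewrite k0.
    by split=> //; exists i.
  by apply: mG => //; rewrite /K Hk; apply/existsP; exists (Ordinal i'k).
have iF := ltn_trans (ltn_ord i) kF.
(* As the facet contains [\bot], the subtraction in [cG] is exact and [G] omits a single vertex. *)
apply: (IH i) => //; have : #|nth set0 F k :\: G| == 1%N.
  rewrite cardsD (setIidPr Gk) cG subKn // card_gt0; apply/set0Pn.
  by exists \bot; apply/maximal_chain_bot/mF.
case/cards1P => x e; apply: (chain_labels_switch (mF k kF) (mF i iF) _ lk (x := x)).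
by rewrite -e setDDr setDv set0U (setIidPr Gk).
Qed.

(** * Saturated chains as lists, and the labelling by rank *)

Lemma covers_path_lt x s : path covers x s -> path <%O x s.
Proof. by apply: sub_path => y z; exact: covers_lt. Qed.

Lemma max_chain_of_cat x y z s t :
  max_chain_of x y s -> max_chain_of y z t -> max_chain_of x z (s ++ t).
Proof.
case/andP=> ps /eqP ls /andP[pt /eqP lt].
by rewrite /max_chain_of cat_path last_cat ls ps pt lt eqxx.
Qed.

Lemma max_chain_of_le x y s : max_chain_of x y s -> x <= y.
Proof. by case/andP=> /covers_path_lt/lt_path_last + /eqP <-. Qed.

Lemma max_chain_of_refl x s : max_chain_of x x s -> s = [::].
Proof.
case: s => // y s /andP[/=/andP[/covers_lt xy /covers_path_lt/lt_path_last h] /eqP e].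
by have := lt_le_trans xy h; rewrite e ltxx.
Qed.

Lemma max_chain_of_covers x y s : covers x y -> max_chain_of x y s -> s = [:: y].
Proof.
move=> xy; case: s => [/andP[_ /eqP/= e]|z s /andP[/=/andP[xz pz] lz]].
  by have := covers_lt xy; rewrite e ltxx.
have zy : max_chain_of z y s by rewrite /max_chain_of pz.
have e : z = y.
  apply: covers_eq xy _ (max_chain_of_le zy) _; first exact: ltW (covers_lt xz).
  by rewrite gt_eqF // covers_lt.
by rewrite -e in zy *; rewrite (max_chain_of_refl zy).
Qed.

Lemma max_chain_of_exists x y : x <= y -> exists s, max_chain_of x y s.
Proof.
move: {2}#|_|.+1 (ltnSn #|[set z | x < z]|) => k; elim: k x => // k IH x; rewrite ltnS => hk.
rewrite le_eqVlt => /predU1P[->|/covers_above[z xz zy]].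
  by exists [::]; rewrite /max_chain_of /= eqxx.
have [|s /andP[ps ls]] := IH z _ zy; last by exists (z :: s); rewrite /max_chain_of /= xz ps.
apply: leq_trans hk; apply: proper_card; apply/properP; split.
  by apply/subsetP=> w; rewrite !inE; apply: lt_trans (covers_lt xz).
by exists z; rewrite !inE ?ltxx ?covers_lt.
Qed.

Lemma mem_labels {Q : eqType} (f : T -> T -> Q) x s l : path covers x s ->
  l \in pairmap f x s -> exists b c, [/\ covers b c, x <= b, c <= last x s & l = f b c].
Proof.
elim: s x => //= y s IH x /andP[xy ps]; rewrite inE => /predU1P[->|/(IH _ ps)].
  by exists x, y; split=> //; apply/lt_path_last/covers_path_lt.
case=> b [c [bc yb cl ->]]; exists b, c; split=> //.
exact: le_trans (ltW (covers_lt xy)) yb.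
Qed.

(** On covers the default is never taken, by [edge_labelP]. *)
Definition edge_label x y : T * T := odflt (x, y) [pick p | labels_edge p x y].

Lemma edge_labelP x y : covers x y -> labels_edge (edge_label x y) x y.
Proof.
move=> xy; rewrite /edge_label; case: pickP => //= h.
by have [p] := sep (covers_lt xy); rewrite h.
Qed.

Lemma edge_label_eq p x y : covers x y -> labels_edge p x y -> edge_label x y = p.
Proof. by move=> xy; apply: labels_edge_uniq (edge_labelP xy). Qed.

Lemma edge_label_kappa x y : covers x y -> kappa_pair (edge_label x y).
Proof. by move/edge_labelP => /and3P[]. Qed.

Section Order.

Context (t0 : seq (T * T)).
Hypothesis ord_t0 : kappa_order t0.

Definition rank x y : nat := index (edge_label x y) t0.

Lemma kappa_order_mem p : kappa_pair p -> p \in t0.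
Proof. by move=> kp; case: ord_t0 => _ -> _; rewrite inE. Qed.

Lemma kappa_order_le p q : kappa_pair p -> kappa_pair q ->
  (index p t0 < index q t0)%N -> p.1 <= q.2.
Proof.
move=> /kappa_order_mem pt /kappa_order_mem qt lt_pq; case: ord_t0 => _ _ pw.
rewrite -(nth_index p pt) -[q](nth_index p qt).
by move/(pairwiseP p): pw; apply; rewrite ?inE ?index_mem.
Qed.

Lemma rank_inj x y z : covers x y -> covers x z -> rank x y = rank x z -> y = z.
Proof.
move=> xy xz e; have labs := edge_labelP xy.
rewrite -(labels_edge_join xy labs) -(labels_edge_join xz (edge_labelP xz)).
congr (_ `|` _.1).
by rewrite -(nth_index (x, x) (kappa_order_mem (edge_label_kappa xy))) [index _ _]e
  nth_index // kappa_order_mem // edge_label_kappa.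
Qed.

(** Take a separating pair [q] of least index and a cover [w] of [x] below the join of [x] with the
    j of [q]. If [q] came before the label (j', m') of this cover, then [w] would lie below m'. *)
Lemma covers_above_min_rank x y : x < y -> exists w, [/\ covers x w, w <= y &
  forall p, labels_edge p x y -> (rank x w <= index p t0)%N].
Proof.
move=> xy; have [p0 lp0] := sep xy.
case: (@arg_minnP _ p0 (fun p => labels_edge p x y) (fun p => index p t0) lp0).
move=> q lq qmin; have [kq qy xq] := and3P lq.
have xlt : x < x `|` q.1.
  by rewrite lt_neqAle leUl andbT eq_sym joinC -leEjoin (labels_edge_not_le lq).
have [w xw wxq] := covers_above xlt; exists w; split=> //.
  by apply: le_trans wxq _; rewrite leUx qy ltW.
move=> p lp; apply: leq_trans (qmin _ lp); rewrite leqNgt; apply/negP.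
have lw := edge_labelP xw; have [kw _ xw2] := and3P lw.
move/(kappa_order_le kq kw) => qw; have := labels_edge_not_ge lw.
by rewrite (le_trans wxq) // leUx xw2.
Qed.

(** Consider the step at which the path first rises above the j of [p], with label (j', m'). If [p]
    came before that label, j would lie below m', hence already below the start of the step. *)
Lemma rank_along_path x s p : path covers x s -> kappa_pair p ->
  p.1 <= x = false -> p.1 <= last x s ->
  exists2 l, l \in pairmap rank x s & (l <= index p t0)%N.
Proof.
elim: s x => /= [x _ _ -> //|y s IH x /andP[xy ps] kp px pl].
have [py|py] := boolP (p.1 <= y); last first.
  have [l ls lp] := IH y ps kp (negbTE py) pl.
  by exists l => //; rewrite inE ls orbT.
exists (rank x y); first by rewrite inE eqxx.
rewrite leqNgt; apply/negP; have lab := edge_labelP xy.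
move/(kappa_order_le kp (edge_label_kappa xy)) => p2; move/negP: px; apply.
by rewrite -(labels_edge_meet xy lab) lexI py.
Qed.

(** The increasing chain starts greedily with the cover of least rank. Any chain from [x] to [y]
    uses some rank at most this one, so an increasing one must use it first, and [rank_inj] fixes
    the cover. Any other first cover has larger rank. *)
Lemma sorted_rank_EL x y : x <= y -> exists s,
  [/\ max_chain_of x y s, sorted leq (pairmap rank x s),
      (forall t, max_chain_of x y t -> sorted leq (pairmap rank x t) -> t = s)
    & (forall t, max_chain_of x y t -> t <> s ->
         exists (r : seq nat) (i j : nat) u v, [/\ pairmap rank x s = r ++ i :: u,
           pairmap rank x t = r ++ j :: v & (i < j)%N])].
Proof.
move: {2}#|_|.+1 (ltnSn #|[set z | x < z]|) => k; elim: k x => // k IH x; rewrite ltnS => hk.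
rewrite le_eqVlt => /predU1P[->|xy].
  exists [::]; split=> //; first by rewrite /max_chain_of /= eqxx.
    by move=> t /max_chain_of_refl.
  by move=> t /max_chain_of_refl.
have [w [xw wy wmin]] := covers_above_min_rank xy.
have [|s [ms ss us ls]] := IH w _ wy.
  apply: leq_trans hk; apply: proper_card; apply/properP; split.
    by apply/subsetP=> z; rewrite !inE; apply: lt_trans (covers_lt xw).
  by exists w; rewrite !inE ?ltxx ?covers_lt.
have labw : labels_edge (edge_label x w) x y.
  by have /and3P[kw hw xw'] := edge_labelP xw; rewrite /labels_edge kw xw' (le_trans hw).
have rmin b c : covers b c -> x <= b -> c <= y -> (rank x w <= rank b c)%N.
  move=> bc xb cy; apply: wmin; have /and3P[kb hb h'b] := edge_labelP bc.
  by rewrite /labels_edge kb (le_trans hb) // (le_trans xb).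
exists (w :: s); split.
- by move: ms; rewrite /max_chain_of /= xw.
- rewrite /= (path_sortedE leq_trans) ss andbT; apply/allP => l.
  have [ps /eqP lst] := andP ms.
  case/(mem_labels ps) => b [c [bc wb cl ->]]; apply: rmin => //.
    exact: le_trans (ltW (covers_lt xw)) wb.
  by rewrite -lst.
- case=> [|c t]; first by case/andP => _ /eqP /= e; rewrite e ltxx in xy.
  case/andP => /= /andP[xc pt] lt srt; have [kw ww xw'] := and3P (edge_labelP xw).
  have [||l lt' llw] := rank_along_path (s := c :: t) _ kw (labels_edge_not_le labw) _.
  - by rewrite /= xc.
  - by rewrite /= (eqP lt) (le_trans ww).
  have cw : c = w.
    apply: (rank_inj xc xw); apply/eqP; rewrite eqn_leq rmin // -?(eqP lt) ?andbT.
      apply: leq_trans llw; move: lt'; rewrite inE => /predU1P[-> //|].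
      by move: srt; rewrite (path_sortedE leq_trans) => /andP[/allP h _] /h.
    exact/lt_path_last/covers_path_lt.
  rewrite cw in pt lt srt *; congr cons; apply: us; first by rewrite /max_chain_of pt.
  exact: path_sorted srt.
- case=> [|c t]; first by case/andP => _ /eqP /= e; rewrite e ltxx in xy.
  case/andP => /= /andP[xc pt] lt ne.
  have [cw|cw] := eqVneq c w.
    rewrite cw in pt lt ne *; have [||r [i [j [u [v [e1 e2 ij]]]]]] := ls t.
    - by rewrite /max_chain_of pt.
    - by move=> e; apply: ne; rewrite e.
    by exists (rank x w :: r), i, j, u, v; rewrite /= e1 e2.
  exists [::], (rank x w), (rank x c), (pairmap rank w s), (pairmap rank c t); split=> //.
  rewrite ltn_neqAle rmin // -?(eqP lt) ?andbT.
    by apply: contraNneq cw => /(rank_inj xw xc) ->.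
  exact/lt_path_last/covers_path_lt.
Qed.

Lemma rank_EL_labelling : @EL_labelling d T _ nat rank.
Proof.
move=> x y /sorted_rank_EL[s [ms ss us ls]]; exists s; split=> // t mt ts.
have [r [i [j [u [v [e1 e2 ij]]]]]] := ls t mt ts.
by left; exists r, i, j, u, v.
Qed.

Lemma unsorted_descent x s (f : T -> T -> nat) : ~~ sorted leq (pairmap f x s) ->
  exists u z c v, s = u ++ z :: c :: v /\ (f z c < f (last x u) z)%N.
Proof.
elim: s x => // y [//|z s] IH x /=; rewrite negb_and -ltnNge => /orP[h|/IH].
  by exists [::], y, z, s.
by case=> u [w [c [v [-> h]]]]; exists (y :: u), w, c, v.
Qed.

Let key x s : seqlexi nat := pairmap rank x s.

(** Where the chains part, [s] takes the cover of smaller rank. Up to its first return to [s], [t]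
    must use a rank at most that one, so this segment is not increasing and has a descent at an
    interior point, which lies off [s]. *)
Lemma key_descent x s t : path covers x s -> path covers x t -> last x s = last x t ->
  s <> t -> key x s <= key x t -> exists u z c v,
    [/\ t = u ++ z :: c :: v, z \notin s & (rank z c < rank (last x u) z)%N].
Proof.
elim: t x s => [|y t IH] x [|y' s] /=.
- by move=> _ _ _ [].
- move=> /andP[/covers_lt xy /covers_path_lt/lt_path_last h] _ e.
  by have := lt_le_trans xy h; rewrite e ltxx.
- move=> _ /andP[/covers_lt xy /covers_path_lt/lt_path_last h] e.
  by have := lt_le_trans xy h; rewrite -e ltxx.
move=> /andP[xy' ps] /andP[xy pt] lst ne; rewrite /key /= lexi_cons.
have [e|ney] := eqVneq y' y.
  rewrite e lexx in ps lst ne * => /= le_key.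
  have [|u [z [c [v [e1 zs lt]]]]] := IH _ _ ps pt lst _ le_key.
    by move=> e'; apply: ne; rewrite e'.
  exists (y :: u), z, c, v; rewrite /= e1 inE negb_or zs andbT; split=> //.
  have : path <%O y t by exact: covers_path_lt.
  rewrite lt_path_sortedE => /andP[/allP h _]; rewrite gt_eqF // h //.
  by rewrite e1 mem_cat inE eqxx orbT.
case/andP => le_rank _; have lt_rank : (rank x y' < rank x y)%N.
  by rewrite ltn_neqAle; apply/andP; split=> //; apply: contraNneq ney => /(rank_inj xy' xy) ->.
(* [v] is the first element of [y :: t] on [y' :: s]; it exists because the chains end at the same
   point. *)
have [v [u1 [u2 [et vs u1s]]]] : exists v u1 u2,
    [/\ y :: t = rcons u1 v ++ u2, v \in y' :: s & ~~ has (mem (y' :: s)) u1].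
  have h : has (mem (y' :: s)) (y :: t).
    by apply/hasP; exists (last y t); rewrite ?mem_last // /= -lst mem_last.
  by case/split_find: (h) => v u1 u2 vs u1s; exists v, u1, u2.
have pv : path covers x (rcons u1 v).
  have pyt : path covers x (y :: t) by rewrite /= xy.
  by move: pyt; rewrite et cat_path => /andP[].
have y'v : y' <= v.
  move: vs; rewrite inE => /predU1P[-> //|vs]; have := covers_path_lt ps.
  by rewrite lt_path_sortedE => /andP[/allP/(_ _ vs)/ltW].
have lab := edge_labelP xy'.
have [|l lv lr] := rank_along_path pv (edge_label_kappa xy') (labels_edge_not_le lab).
  by rewrite last_rcons (le_trans _ y'v) //; case/and3P: lab.
have [t1 et1] : exists t1, rcons u1 v = y :: t1.
  by case: (u1) et => [|c u3] [-> _]; eexists.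
have [|u [z [c [w [ev lt]]]]] := @unsorted_descent x (rcons u1 v) rank.
  rewrite et1 /= (path_sortedE leq_trans); apply/negP => /andP[/allP srt _].
  move: lv; rewrite et1 inE => /predU1P[e|/srt le_l].
    by rewrite e leqNgt lt_rank in lr.
  by have := leq_trans le_l lr; rewrite leqNgt lt_rank.
exists u, z, c, (w ++ u2); split=> //; first by rewrite et ev -catA.
have : u1 = u ++ z :: belast c w.
  by move: ev; rewrite (lastI c) -rcons_cons -rcons_cat => /rcons_inj[].
move=> e1; apply: contra u1s => zs; apply/hasP; exists z => //.
by rewrite e1 mem_cat inE eqxx orbT.
Qed.

(** The label of the cover from [z] to [c] also separates the predecessor of [z] from [c]. So a
    cover of least rank there has rank below that of the step into [z], and rerouting through it
    lowers the key at that position. *)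
Lemma key_switch x y u z c v : max_chain_of x y (u ++ z :: c :: v) ->
  (rank z c < rank (last x u) z)%N -> exists r,
    [/\ max_chain_of x y (u ++ r ++ v), c \in r & key x (u ++ r ++ v) < key x (u ++ z :: c :: v)].
Proof.
set b := last x u; rewrite /max_chain_of cat_path last_cat /= -/b => /andP[/and4P[pu bz zc pv] lv] lt.
have bc : b < c := lt_trans (covers_lt bz) (covers_lt zc).
have [w [bw wc wmin]] := covers_above_min_rank bc.
have [r /andP[pr lr]] := max_chain_of_exists wc.
have lt_w : (rank b w < rank b z)%N.
  apply: leq_ltn_trans lt; apply: wmin; have /and3P[kz hc hz] := edge_labelP zc.
  by rewrite /labels_edge kz hc (le_trans (ltW (covers_lt bz))).
exists (w :: r); rewrite !cat_path !last_cat /= -/b pu bw pr (eqP lr) pv lv; split=> //.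
  by rewrite -(eqP lr) mem_last.
rewrite /key !pairmap_cat /= -/b; move: (pairmap rank x u) => r0.
elim: r0 => [|i r0 IH] /=; last by rewrite ltxi_cons lexx.
by rewrite ltxi_cons leEnat (ltnW lt_w) leqNgt lt_w.
Qed.
End Order.

(** * Facets as lists, and the lexicographic shelling *)

Definition chain_path A : seq T := behead (sort <=%O (enum A)).

Lemma maximal_chain_path A : @maximal_chain d T A ->
  max_chain_of \bot \top (chain_path A) /\ (\bot :: chain_path A =i A).
Proof.
move=> mA; have [chA _] := mA; have := chain_sort_sorted chA; have mem := mem_sort_enum A.
rewrite /chain_path; case: (sort _ _) mem => [|x s] mem.
  by have := maximal_chain_bot mA; rewrite -mem.
move=> /= pth; have ex : x = \bot.
  have := maximal_chain_bot mA; rewrite -mem inE => /predU1P[//|].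
  by move: pth; rewrite lt_path_sortedE => /andP[/allP h _] /h; rewrite ltx0.
rewrite ex in mem pth *; split=> //; apply/andP; split; last first.
  rewrite eq_le lex1 /=; apply: lt_path_le_last => //.
  by rewrite mem maximal_chain_top.
have sub z : z \in \bot :: s -> z \in A by rewrite mem.
have sup z : z \in A -> \bot <= z -> z \in \bot :: s by rewrite mem.
(* The starting point is generalised to [b]; the invariant is that [b :: s] lists exactly the
   elements of [A] above [b]. *)
move: sub sup pth {ex mem}; elim: s \bot => //= y s IH b sub sup /andP[b_y pth].
have [bA yA] : b \in A /\ y \in A by rewrite !sub ?inE ?eqxx ?orbT.
have [w wA /andP[bw wy]] := maximal_chain_succ mA bA yA b_y.
have := sup w wA (ltW (covers_lt bw)); rewrite !inE gt_eqF ?covers_lt //=.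
case/predU1P => [ew|ws]; last first.
  move: pth; rewrite lt_path_sortedE => /andP[/allP/(_ _ ws)/lt_le_trans/(_ wy)].
  by rewrite ltxx.
rewrite -ew bw ew /=; apply: IH => // z.
  by move=> zs; apply: sub; rewrite inE zs orbT.
move=> zA yz; have := sup z zA (le_trans (ltW b_y) yz).
by rewrite inE gt_eqF // (lt_le_trans b_y).
Qed.

Lemma max_chain_of_maximal s :
  max_chain_of \bot \top s -> @maximal_chain d T [set z in \bot :: s].
Proof.
case/andP => ps /eqP ls; have plt := covers_path_lt ps.
split; first exact: lt_path_chain.
move=> B chB /subsetP sB; apply/eqP; rewrite eqEsubset; apply/andP; split; last exact/subsetP.
apply/subsetP => z zB; rewrite inE -[_ \in _]/(z \in \bot :: s).
have : z <= last \bot s by rewrite ls lex1.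
have : \bot <= z by rewrite le0x.
have {sB} : {in \bot :: s, forall y, y \in B} by move=> y ys; apply: sB; rewrite inE.
move: ps; elim: (s) (\bot : T) {ls plt} => [|y t IH] b /=.
  by move=> _ _ bz zb; rewrite inE eq_le bz zb.
move=> /andP[b_y pt] sB bz zl; rewrite inE.
have yB : y \in B by apply: sB; rewrite !inE eqxx orbT.
have [-> //|zb /=] := eqVneq z b.
apply: IH => // [w wt|]; first by apply: sB; rewrite inE wt orbT.
have /orP[//|zy] := chB _ _ yB zB.
by rewrite (covers_eq b_y bz zy zb).
Qed.

Lemma chain_path_set s : max_chain_of \bot \top s -> chain_path [set z in \bot :: s] = s.
Proof.
move=> ms; have mA := max_chain_of_maximal ms.
suff : \bot :: chain_path [set z in \bot :: s] = \bot :: s by case.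
have [/andP[p1 _] e1] := maximal_chain_path mA.
apply: lt_sorted_eq; [exact: covers_path_lt | by case/andP: ms => /covers_path_lt |].
by move=> z; rewrite e1 inE.
Qed.

Lemma set_chain_path A : @maximal_chain d T A -> [set z in \bot :: chain_path A] = A.
Proof. by move=> /maximal_chain_path[_ e]; apply/setP => z; rewrite inE -e. Qed.

(** Facets are sorted by key. For a face shared with an earlier facet, [key_descent] gives a descent
    z of [Fj] off that facet, and [key_switch] a facet of smaller key containing [Fj] without z.
    This set contains the face, so a maximal face equals it. *)
Lemma kappa_order_shellable t : kappa_order t -> @shellable d T.
Proof.
move=> ord_t.
pose key (A : {set T}) : seqlexi nat := pairmap (rank t) \bot (chain_path A).
pose leF (A B : {set T}) := key A <= key B.
have leF_total : total leF by move=> A B; exact: le_total.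
have leF_trans : transitive leF by move=> A B C; exact: le_trans.
pose F := sort leF (enum (maxset chainb)).
have memF A : A \in F <-> @maximal_chain d T A.
  by rewrite mem_sort mem_enum; split => /maximal_chainP.
have srtF : sorted leF F by exact: sort_sorted.
have leF_nth i j : (i <= j)%N -> (j < size F)%N -> leF (nth set0 F i) (nth set0 F j).
  move=> ij jF; apply: (sorted_leq_nth leF_trans (fun A => lexx (key A))) => //.
  by rewrite inE (leq_ltn_trans ij).
exists F; split=> //; first by rewrite sort_uniq enum_uniq.
move=> j /andP[j0 jF] Fj K G [GFj [i ij GFi]] mG.
have mFj : @maximal_chain d T Fj by apply/memF; rewrite mem_nth.
have iF := ltn_trans ij jF.
have mFi : @maximal_chain d T (nth set0 F i) by apply/memF; rewrite mem_nth.
have [cj ej] := maximal_chain_path mFj; have [ci ei] := maximal_chain_path mFi.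
have [|||u [z [c [v [ecj zi lt]]]]] := key_descent ord_t (proj1 (andP ci)) (proj1 (andP cj)).
- by case/andP: ci => _ /eqP->; case/andP: cj => _ /eqP->.
- move=> e; have eF : nth set0 F i = nth set0 F j.
    by rewrite -(set_chain_path mFi) e set_chain_path.
  by move/eqP: eF; rewrite nth_uniq ?sort_uniq ?enum_uniq // ltn_eqF.
- exact: leF_nth (ltnW ij) jF.
have cj' := cj; rewrite ecj in cj'; have [r [mr cr key_lt]] := key_switch ord_t cj' lt.
have mF' := max_chain_of_maximal mr; set F' := [set y in _] in mF'.
have /memF F'F := mF'; have lF : (index F' F < size F)%N by rewrite index_mem.
(* Had [F'] come at or after position [j], sorting would contradict its strictly smaller key. *)
have lj : (index F' F < j)%N.
  rewrite ltnNge; apply/negP => /leF_nth/(_ lF); rewrite nth_index // /leF leNgt.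
  by rewrite /key chain_path_set // -/Fj ecj key_lt.
have zj : z \in Fj by rewrite -ej ecj inE mem_cat inE eqxx !orbT.
have z0 : z != \bot.
  have [/covers_path_lt + _] := andP cj; rewrite lt_path_sortedE => /andP[/allP h _].
  by rewrite gt_eqF // h // ecj mem_cat inE eqxx orbT.
have <- : Fj :\ z = G; last by rewrite (cardsD1 z Fj) zj add1n subn1.
apply: mG.
  split; first exact: subsetDl.
  exists (index F' F) => //; rewrite nth_index //; apply/subsetP => y.
  rewrite !inE -ej ecj inE !mem_cat !inE => /andP[/negbTE->] /=.
  by case/or4P => [->|->|/eqP->|->]; rewrite ?cr ?orbT.
apply/subsetP => y yG; rewrite !inE (subsetP GFj) // andbT.
apply: contraNneq zi => ey; rewrite ey in yG; have := subsetP GFi _ yG.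
by rewrite -ei inE (negbTE z0).
Qed.

(** * From an EL-labelling to extremality *)

Lemma max_chain_labels_size s : max_chain_of \bot \top s ->
  (forall p, kappa_pair p -> p \in pairmap edge_label \bot s) -> @extremal d T.
Proof.
case/andP => /covers_path_lt ps _ h; apply: (extremal_lt_path ps).
rewrite -(size_pairmap edge_label \bot s); apply: leq_trans (card_size _).
by apply/subset_leq_card/subsetP => p; rewrite inE; exact: h.
Qed.

Lemma edge_label_switch_up x a y b : covers x a -> covers a y -> covers b y ->
  x <= b -> b != a -> edge_label b y = edge_label x a.
Proof.
move=> xa ay b_y xb ba; apply: edge_label_eq => //.
exact: (labels_edge_switch_up xa ay) (edge_labelP xa).
Qed.

Lemma edge_label_switch_down x a y b : covers x a -> covers a y -> covers x b ->
  b <= y -> b != a -> edge_label x b = edge_label a y.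
Proof.
move=> xa ay xb b_y ba; apply: edge_label_eq => //.
exact: (labels_edge_switch_down xa ay) (edge_labelP ay).
Qed.

(* If the chain is not increasing, make it increasing above its first element a; then a is a
   descent, and resolving it strictly decreases the label of the first cover. *)
Lemma EL_labels_sub {dQ : Order.disp_t} {Q : porderType dQ} (lam : T -> T -> Q) x y s t :
  @EL_labelling d T dQ Q lam -> max_chain_of x y s -> sorted <=%O (labels lam x s) ->
  max_chain_of x y t -> {subset pairmap edge_label x t <= pairmap edge_label x s}.
Proof.
move=> EL; move: {2}#|_|.+1 (ltnSn #|[set z | x < z]|) => k.
elim: k x s t => // k IHk x s t; rewrite ltnS => hk ms ss mt.
case: t mt => // a t mt.
(* [Q] may be infinite, so the inner induction counts lattice elements [z] with a smaller value
   [lam x z]. *)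
move: {2}#|_|.+1 (ltnSn #|[set z | lam x z < lam x a]|) => l.
elim: l a t mt => // l IHl a t mt; rewrite ltnS => hl.
have [/= /andP[xa pt] lt] := andP mt.
have mat : max_chain_of a y t by rewrite /max_chain_of pt.
have [s1 [ms1 ss1 _ _]] := EL a y (max_chain_of_le mat).
have lt_a : (#|[set z | a < z]%O| < k)%N.
  apply: leq_trans hk; apply: proper_card; apply/properP; split.
    by apply/subsetP=> z; rewrite !inE; apply: lt_trans (covers_lt xa).
  by exists a; rewrite !inE ?ltxx ?covers_lt.
(* The outer induction at [a] places the labels of [t] on the increasing chain [s1]. *)
suff sub : {subset pairmap edge_label x (a :: s1) <= pairmap edge_label x s}.
  move=> p; rewrite /= inE => /predU1P[->|/(IHk _ _ _ lt_a ms1 ss1 mat) ps].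
    by apply: sub; rewrite /= inE eqxx.
  by apply: sub; rewrite /= inE ps orbT.
have mas1 : max_chain_of x y (a :: s1) by case/andP: ms1 => p1 l1; rewrite /max_chain_of /= xa p1.
have [s0 [ms0 ss0 us0 _]] := EL x y (max_chain_of_le ms).
have es : s = s0 by apply: us0.
have [sa|nsa] := boolP (sorted <=%O (labels lam x (a :: s1))).
  by have -> : s = a :: s1 by rewrite es; apply/esym/us0.
case: s1 ms1 ss1 mas1 nsa => [|b s1] // ms1 ss1 mas1.
have [/= /andP[ab pb] lb] := andP ms1.
rewrite /= in ss1 *; rewrite ss1 andbT => nle.
have xb : x <= b by apply: ltW; apply: lt_trans (covers_lt xa) (covers_lt ab).
have [r [mr sr _ lr]] := EL x b xb.
have mab : max_chain_of x b [:: a; b] by rewrite /max_chain_of /= xa ab eqxx.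
have ner : [:: a; b] <> r by move=> e; move: sr; rewrite -e /= (negbTE nle).
have {lr} := lr _ mab ner.
case: r mr sr ner => [|r1 [|r2 r]] mr sr ner.
- by have := lt_trans (covers_lt xa) (covers_lt ab); case/andP: mr => _ /eqP /= ->; rewrite ltxx.
- have [/= /andP[xr _] /eqP er] := andP mr; rewrite er in xr.
  by have := max_chain_of_covers xr mab.
have [/= /and3P[xr1 r12 pr] er] := andP mr.
have mr1 : max_chain_of r1 b (r2 :: r) by rewrite /max_chain_of /= r12 pr.
have r1a : r1 != a.
  by apply/eqP => e; apply: ner; rewrite e in mr1 *; rewrite (max_chain_of_covers ab mr1).
(* If the first labels agreed, the second label of the increasing chain would be smaller than
   [lam a b], making [lam x a <= lam a b], against the descent. *)
move=> lex; have lt_r1 : lam x r1 < lam x a.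
  case: lex => [[w [i [j [u [v [e1 e2 ij]]]]]]|[j [v]]]; last first.
    by move/(congr1 size); rewrite /= size_cat /= addnS.
  case: w e1 e2 ij => [|i1 [|i2 w]] /=.
  - by case=> <- _ [<- _].
  - case=> e1 e1' _ [e2 e2' _] ij; move: sr nle => /= /andP[le12 _]; rewrite e2 e2' -e1.
    by rewrite (le_trans le12) // e1' ltW.
  - by case=> _ _ _ [_ _]; case: (w).
have mrs : max_chain_of x y (r1 :: r2 :: r ++ s1).
  by apply: (max_chain_of_cat mr); rewrite /max_chain_of pb.
have r1b : r1 <= b := max_chain_of_le mr1.
have sub : {subset pairmap edge_label x (r1 :: r2 :: r ++ s1) <= pairmap edge_label x s}.
  apply: IHl => //; apply: leq_trans hl; apply: proper_card; apply/properP; split.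
    by apply/subsetP => z; rewrite !inE => /lt_trans; apply.
  by exists r1; rewrite !inE ?ltxx.
(* The kappa labels of the two covers at [a] reappear on the new chain: the upper one on its first
   cover, the lower one on its last cover below [b]. *)
have lab1 : edge_label a b = edge_label x r1 by rewrite (edge_label_switch_down xa ab xr1).
have lab2 : edge_label x a \in pairmap edge_label r1 (r2 :: r).
  move: (mr1); case/lastP: (r2 :: r) => [/andP[_ /eqP/= e]|r' b'].
    rewrite e in xr1; have := max_chain_of_covers xr1 mab; by [].
  rewrite /max_chain_of rcons_path last_rcons => /andP[/andP[pr' r'b] /eqP eb].
  rewrite eb in r'b; rewrite -cats1 pairmap_cat mem_cat /= inE eb.
  have r1r' := lt_path_last (covers_path_lt pr').
  rewrite (edge_label_switch_up xa ab r'b) ?eqxx ?orbT //.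
    exact: le_trans (ltW (covers_lt xr1)) r1r'.
  apply: contraNneq r1a => e; rewrite e in r1r'; apply/eqP.
  by apply: covers_eq xa (ltW (covers_lt xr1)) r1r' _; rewrite gt_eqF ?covers_lt.
move=> p; rewrite !inE => /or3P[/eqP->|/eqP->|ps]; apply: sub.
- by rewrite -[_ :: _ :: _ ++ _]/((r1 :: r2 :: r) ++ s1) pairmap_cat mem_cat /= inE lab2 orbT.
- by rewrite /= inE lab1 eqxx.
- by rewrite -[_ :: _ :: _ ++ _]/((r1 :: r2 :: r) ++ s1) pairmap_cat mem_cat /= (eqP er) ps !orbT.
Qed.

(** For each kappa pair, a maximal chain through the cover below j carries it, so the increasing
    chain from [\bot] to [\top] carries it as well. *)
Lemma EL_shellable_extremal : @EL_shellable d T -> @extremal d T.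
Proof.
case=> dQ [Q [lam EL]]; have [s [ms ss _ _]] := EL \bot \top (le0x _).
apply: (max_chain_labels_size ms) => p kp.
have [u mu] := max_chain_of_exists (le0x (p.1 `&` p.2)).
have [v mv] := max_chain_of_exists (lex1 p.1).
have mc : max_chain_of (p.1 `&` p.2) p.1 [:: p.1].
  by rewrite /max_chain_of /= kappa_covers // eqxx.
apply: (EL_labels_sub EL ms ss (max_chain_of_cat mu (max_chain_of_cat mc mv))).
rewrite pairmap_cat mem_cat /=; case/andP: mu => _ /eqP->; rewrite inE.
by rewrite (edge_label_eq (kappa_covers kp) (kappa_labels_edge kp)) eqxx orbT.
Qed.

End Separated.

End KappaPairs.

Theorem theorem3p26 (d : Order.disp_t) (T : finTBLatticeType d) :
  @congruence_uniform d T ->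
  [/\ (@extremal d T <-> @left_modular d T),
      (@left_modular d T <-> @EL_shellable d T)
    & (@EL_shellable d T <-> @shellable d T)].
Proof.
move=> /congruence_uniform_separated sep.
(* All equivalences pass through extremality. *)
have LM : @extremal d T -> @left_modular d T.
  by move=> /(extremal_kappa_order sep)[t]; exact: kappa_order_left_modular.
have EL : @extremal d T -> @EL_shellable d T.
  move=> /(extremal_kappa_order sep)[t /(rank_EL_labelling sep) h].
  by exists _, nat, (rank t).
have SH : @extremal d T -> @shellable d T.
  by move=> /(extremal_kappa_order sep)[t]; exact: kappa_order_shellable.
have := left_modular_extremal sep; have := EL_shellable_extremal sep.
by have := shellable_extremal sep; split; split; auto.
Qed.
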